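(* Let $n\ge 6$ and $q=2^n$. For $a\in\mathbb{F}_q$ let \[\mathcal{K}(a)=\sum_{x\in\mathbb{F}_{q}}(-1)^{\Tr(x^{q-2}+ax)}\] and let $\widehat{\Tr}(a)=\sum_{i=0}^{n-1}\omega(a)^{2^i}$ be the lifted trace. Then $\mathcal{K}(a)\bmod 64$ is determined by $\widehat{\Tr}(a)\bmod 16$ as follows: \[ \begin{array}{c|cccccccccccccccc} \widehat{\Tr}(a)\bmod 16 & 0&11&10&13&4&15&14&1&8&3&2&5&12&7&6&9\\\hline \mathcal{K}(a)\bmod 64 & 0&4&8&12&16&20&24&28&32&36&40&44&48&52&56&60 \end{array} \] i.e. $\mathcal{K}(a)\equiv 0\pmod{64}$ if $\widehat{\Tr}(a)\equiv 0\pmod{16}$, $\mathcal{K}(a)\equiv 4\pmod{64}$ if $\widehat{\Tr}(a)\equiv 11\pmod{16}$, and so on for each column.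
   Context: $\Tr:\mathbb{F}_{2^n}\to\mathbb{F}_2$ is the absolute trace. Fix an algebraic closure of the $2$-adic numbers $\mathbb{Q}_2$, a primitive $(q-1)$-th root of unity $\xi$ in it, and a generator $t$ of $\mathbb{F}_q^\times$. The Teichmüller character $\omega:\mathbb{F}_q\to\mathbb{Q}_2(\xi)$ is defined by $\omega(t^j)=\xi^j$ and $\omega(0)=0$. The lifted trace $\widehat{\Tr}(a)=\sum_{j}\omega(a^j)$, summing over $j\in\{1,\dots,2^n-2\}$ of binary weight $1$ (i.e. $j=2^i$, $0\le i\le n-1$), is a $2$-adic integer, and congruences modulo $16$ are taken in the ring of $2$-adic integers (equivalently in the ring of integers of $\mathbb{Q}_2(\xi)$). Note $x^{q-2}=x^{-1}$ for $x\ne0$ and $0^{q-2}=0$.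
   Formalization: The root of unity ξ and the generator t are assumed compatible (t is the residue class of ξ modulo 2), so that ω is the true Teichmüller character; for independently chosen ξ and t the claim is false (e.g. n=6 with ω replaced by its 5th power). *)

(* Defs.v *)
From HB Require Import structures.
From mathcomp Require Import all_boot all_order all_algebra all_fingroup.
From mathcomp Require Import all_solvable all_field.
From mathcomp Require Import boolp.

Set Implicit Arguments.
Unset Strict Implicit.
Unset Printing Implicit Defensive.

Import Order.TTheory GRing.Theory Num.Theory.
Local Open Scope ring_scope.

(* The 2-adic integers as the inverse limit of the rings Z/2^k. The coherence
   condition also forces 0 <= x k < 2^k, so that equality is pointwise. *)
Record Z2 := MkZ2 {
  Z2digits :> nat -> int;
  Z2P : forall k, Z2digits k = (Z2digits k.+1 %% (2 ^+ k))%Z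
}.

HB.instance Definition _ := gen_eqMixin Z2.
HB.instance Definition _ := gen_choiceMixin Z2.

Section Z2Ring.

Implicit Types x y z : Z2.

Lemma Z2_eqP x y : (forall k, x k = y k) -> x = y.
Proof.
case: x y => [f fP] [g gP] /= fg; have {}fg : f = g by apply/funext.
by case: _ / fg gP => gP; congr MkZ2; apply: Prop_irrelevance.
Qed.

Lemma Z2_small x k : (x k %% 2 ^+ k)%Z = x k.
Proof. by rewrite [in LHS]Z2P modz_mod -Z2P. Qed.

Lemma modz_pow2S (m : int) k :
  ((m %% 2 ^+ k.+1)%Z %% 2 ^+ k)%Z = (m %% 2 ^+ k)%Z.
Proof.
by rewrite [in RHS](divz_eq m (2 ^+ k.+1)) exprS mulrA modzMDl.
Qed.

(* Reduction modulo 2^k of a family coherent up to congruence. *)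
Lemma Z2_mk_subproof (f : nat -> int)
    (fP : forall k, (f k.+1 = f k %[mod 2 ^+ k])%Z) k :
  (f k %% 2 ^+ k)%Z = ((f k.+1 %% 2 ^+ k.+1)%Z %% 2 ^+ k)%Z.
Proof. by rewrite modz_pow2S fP. Qed.

Definition Z2_mk f fP : Z2 := MkZ2 (@Z2_mk_subproof f fP).

Lemma Z2_cst_subproof (m : int) k : (m = m %[mod 2 ^+ k])%Z.
Proof. by []. Qed.

Lemma Z2_add_subproof x y k :
  (x k.+1 + y k.+1 = x k + y k %[mod 2 ^+ k])%Z.
Proof. by rewrite -modzDm -!Z2P. Qed.

Lemma Z2_opp_subproof x k : (- x k.+1 = - x k %[mod 2 ^+ k])%Z.
Proof. by rewrite -modzNm -Z2P. Qed.

Lemma Z2_mul_subproof x y k :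
  (x k.+1 * y k.+1 = x k * y k %[mod 2 ^+ k])%Z.
Proof. by rewrite -modzMm -!Z2P. Qed.

Definition Z2_of_int (m : int) := Z2_mk (Z2_cst_subproof m).
Definition Z2_add x y := Z2_mk (Z2_add_subproof x y).
Definition Z2_opp x := Z2_mk (Z2_opp_subproof x).
Definition Z2_mul x y := Z2_mk (Z2_mul_subproof x y).

Lemma Z2_addA : associative Z2_add.
Proof. by move=> x y z; apply: Z2_eqP => k /=; rewrite modzDml modzDmr addrA. Qed.

Lemma Z2_addC : commutative Z2_add.
Proof. by move=> x y; apply: Z2_eqP => k /=; rewrite addrC. Qed.

Lemma Z2_add0 : left_id (Z2_of_int 0) Z2_add.
Proof. by move=> x; apply: Z2_eqP => k /=; rewrite modzDml add0r Z2_small. Qed.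

Lemma Z2_addN : left_inverse (Z2_of_int 0) Z2_opp Z2_add.
Proof. by move=> x; apply: Z2_eqP => k /=; rewrite modzDml addNr. Qed.

HB.instance Definition _ :=
  GRing.isZmodule.Build Z2 Z2_addA Z2_addC Z2_add0 Z2_addN.

Lemma Z2_mulA : associative Z2_mul.
Proof. by move=> x y z; apply: Z2_eqP => k /=; rewrite modzMml modzMmr mulrA. Qed.

Lemma Z2_mulC : commutative Z2_mul.
Proof. by move=> x y; apply: Z2_eqP => k /=; rewrite mulrC. Qed.

Lemma Z2_mul1 : left_id (Z2_of_int 1) Z2_mul.
Proof. by move=> x; apply: Z2_eqP => k /=; rewrite modzMml mul1r Z2_small. Qed.

Lemma Z2_mulDl : left_distributive Z2_mul Z2_add.
Proof.
move=> x y z; apply: Z2_eqP => k /=.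
by rewrite modzMml modzDml modzDmr mulrDl.
Qed.

Lemma Z2_1neq0 : Z2_of_int 1 != Z2_of_int 0.
Proof. by apply/eqP => /(congr1 (fun x : Z2 => x 1%N)). Qed.

HB.instance Definition _ := GRing.Zmodule_isComNzRing.Build Z2
  Z2_mulA Z2_mulC Z2_mul1 Z2_mulDl Z2_1neq0.

Definition Z2_unit : {pred Z2} := fun x => `[< exists y, y * x = 1 >].

Definition Z2_inv x : Z2 :=
  if pselect (exists y, y * x = 1) is left h then projT1 (cid h) else x.

Lemma Z2_mulVx : {in Z2_unit, left_inverse 1 Z2_inv *%R}.
Proof.
move=> x /asboolP ux; rewrite /Z2_inv; case: pselect => // h.
exact: projT2 (cid h).
Qed.

Lemma Z2_unitPl x y : y * x = 1 -> Z2_unit x.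
Proof. by move=> yx; apply/asboolP; exists y. Qed.

Lemma Z2_inv_out : {in [predC Z2_unit], Z2_inv =1 id}.
Proof. by move=> x /asboolP nux; rewrite /Z2_inv; case: pselect. Qed.

HB.instance Definition _ := GRing.ComNzRing_hasMulInverse.Build Z2
  Z2_mulVx Z2_unitPl Z2_inv_out.

Lemma Z2_le x k l : (k <= l)%N -> (x l = x k %[mod 2 ^+ k])%Z.
Proof.
move=> /subnK <-; elim: (l - k)%N => [|d IHd] //.
rewrite -IHd [x (d + k)%N]Z2P addSn.
rewrite exprD; set m := x _.+1.
by rewrite [in LHS](divz_eq m (2 ^+ d * 2 ^+ k)) mulrA modzMDl.
Qed.

Lemma Z2_neq0 x : x != 0 -> exists k, ~~ (2 ^+ k %| x k)%Z.
Proof.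
move=> /eqP x0; apply: contrapT => nk; apply: x0; apply: Z2_eqP => k.
have [/dvdz_mod0P|xk] := boolP (2 ^+ k %| x k)%Z; last by case: nk; exists k.
by rewrite Z2_small => ->; rewrite /= mod0z.
Qed.

Lemma pow2_ndvdM (m p : int) k l :
  ~~ (2 ^+ k %| m)%Z -> ~~ (2 ^+ l %| p)%Z -> ~~ (2 ^+ (k + l) %| m * p)%Z.
Proof.
rewrite !dvdzE !abszX abszM /=; move: `|m|%N `|p|%N => {}m {}p mk pl.
have [m0 p0] : (0 < m)%N /\ (0 < p)%N.
  by split; [case: m mk|case: p pl] => //; rewrite dvdn0.
rewrite pfactor_dvdn ?muln_gt0 ?m0 // lognM // -ltnNge.
move: mk pl; rewrite !pfactor_dvdn // -!ltnNge => mk pl.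
by apply: leq_trans (leq_add mk (ltnW pl)); rewrite addSn.
Qed.

Lemma Z2_integral : GRing.integral_domain_axiom Z2.
Proof.
move=> x y xy0; apply/norP => -[/Z2_neq0[k xk] /Z2_neq0[l yl]].
have dvdE z i j : (i <= j)%N -> (2 ^+ i %| z j)%Z = (2 ^+ i %| z i)%Z.
  by move=> ij; apply/dvdz_mod0P/dvdz_mod0P; rewrite (Z2_le z ij).
have := congr1 (fun z : Z2 => z (k + l)%N) xy0; rewrite /= mod0z.
move=> /dvdz_mod0P; apply/negP/pow2_ndvdM.
  by rewrite dvdE ?leq_addr.
by rewrite dvdE ?leq_addl.
Qed.

HB.instance Definition _ := GRing.ComUnitRing_isIntegral.Build Z2 Z2_integral.

End Z2Ring.

Notation Q2 := {fraction Z2}.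

Definition Z2_congr (m : nat) (x y : Z2) := exists w : Z2, x - y = m%:R * w.

Definition is_alg_closure_Q2 (C : closedFieldType) (iota : {rmorphism Q2 -> C}) :=
  forall z : C, algebraicOver iota z.

Definition Z2_emb (C : closedFieldType) (iota : {rmorphism Q2 -> C}) (x : Z2) : C :=
  iota (FracField.tofrac x).

Section FiniteField.

Variable F : finFieldType.

Definition Z2_red (x : Z2) : F := (x 1%N)%:~R.

Definition conj_sum (n : nat) (a : F) : F := \sum_(i < n) a ^+ (2 ^ i).

(* The absolute trace, as an element of F_2: the unique c whose image in F is
   the sum of the n conjugates (see absTrE). *)
Definition absTr (n : nat) (a : F) : 'F_2 :=
  odflt 0 [pick c : 'F_2 | (c : nat)%:R == conj_sum n a].

Lemma absTrE n a : #|F| = (2 ^ n)%N -> (absTr n a : nat)%:R = conj_sum n a.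
Proof.
move=> cardF; have n0 : n != 0%N.
  by apply/eqP => n0; have := finNzRing_gt1 F; rewrite cardF n0.
have ch : 2%N \in [pchar F].
  have [p p_pr chp] := finPcharP F; have := card_pprimeChar chp.
  rewrite cardF; set d := logn _ _ => e.
  suff <- : p = 2%N by [].
  apply/eqP; rewrite eq_sym -(@dvdn_prime2 2) //.
  have : (2 %| p ^ d)%N by rewrite -e dvdn_exp // lt0n.
  by rewrite Euclid_dvdX // => /andP[].
have S2 : conj_sum n a ^+ 2 = conj_sum n a.
  rewrite -[LHS](pFrobenius_autE ch) rmorph_sum /=.
  case: n n0 cardF => // n _ cardF.
  rewrite /conj_sum big_ord_recr big_ord_recl /= addrC; congr (_ + _).
    by rewrite pFrobenius_autE -exprM -expnSr -cardF expf_card.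
  by apply: eq_bigr => i _; rewrite pFrobenius_autE -exprM -expnSr.
rewrite /absTr; case: pickP => [c /eqP //|] nc.
have /eqP : conj_sum n a * (conj_sum n a - 1) = 0.
  by rewrite mulrBr mulr1 -expr2 S2 subrr.
rewrite mulf_eq0 subr_eq0 => /orP[/eqP s0|/eqP s1].
  by have := nc 0; rewrite s0 eqxx.
by have := nc 1; rewrite s1 eqxx.
Qed.

Definition kloosterman (n : nat) (a : F) : int :=
  \sum_(x : F) (-1) ^+ (absTr n (x ^+ (2 ^ n - 2) + a * x) : nat).

Section Teichmuller.

Variables (C : closedFieldType) (iota : {rmorphism Q2 -> C}).
Variables (t : {unit F}) (xi : C).

(* p(xi) |-> (p mod 2)(t) is a well defined map Z_2[xi] -> F, i.e. F is
   identified with the residue field of Z_2[xi] in such a way that t is the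
   residue class of xi. This is what makes t ^+ j |-> xi ^+ j the Teichmuller
   character, and not just one of its powers. *)
Definition reduces_to :=
  forall p : {poly Z2},
    (map_poly (Z2_emb iota) p).[xi] = 0 -> (map_poly Z2_red p).[val t] = 0.

Definition teichmuller (a : F) : C :=
  if [pick j : 'I_(#|F|.-1) | a == val t ^+ j] is Some j then xi ^+ j else 0.

Lemma teichmuller0 : teichmuller 0 = 0.
Proof.
rewrite /teichmuller; case: pickP => // j; rewrite eq_sym expf_eq0.
have : val t \is a GRing.unit by exact: valP t.
by rewrite unitfE => /negPf ->; rewrite andbF.
Qed.

Lemma teichmullerX j :
    generator [set: {unit F}] t -> (#|F|.-1).-primitive_root xi ->
  teichmuller (val t ^+ j) = xi ^+ j.
Proof.
move=> gen_t xi_prim; have ordt : #[t]%g = #|F|.-1.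
  by rewrite -card_finField_unit (eqP gen_t).
have valX i : val t ^+ i = val (t ^+ i)%g by rewrite FinRing.val_unitX.
rewrite /teichmuller; case: pickP => [i|].
  rewrite !valX => /eqP/val_inj/eqP; rewrite eq_expg_mod_order ordt => ij.
  by apply/esym/eqP; rewrite (eq_prim_root_expr xi_prim).
have q0 : (0 < #|F|.-1)%N by rewrite -ordt order_gt0.
move=> /(_ (Ordinal (ltn_pmod j q0))) /=.
by rewrite !valX -ordt -expg_mod_order eqxx.
Qed.

Definition lifted_trace (n : nat) (a : F) : C :=
  \sum_(i < n) teichmuller a ^+ (2 ^ i).

End Teichmuller.

End FiniteField.

Definition kloosterman_table : seq (nat * nat) :=
  [:: (0, 0); (11, 4); (10, 8); (13, 12); (4, 16); (15, 20); (14, 24); (1, 28);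
      (8, 32); (3, 36); (2, 40); (5, 44); (12, 48); (7, 52); (6, 56); (9, 60)]%N.

(* Main.v *)
(* Write q = 2^n, w for the Teichmüller character, T(x) for the lifted trace and
   sums over x <> 0. Expanding (-1)^Tr(x) = (1 - 2)^T(x) binomially modulo 16 and
   using Newton's identities for the conjugates w(x)^(2^i), 3 (-1)^Tr(x) becomes
   3 - 14 e1 + 12 e2 - 24 e3 + 8 T(x^3), with e_k the elementary symmetric
   functions of the conjugates, that is sums of w(x)^m over m of binary weight k.
   Orthogonality of characters then evaluates sum_x (-1)^(Tr(1/x) + Tr(ax)), and
   since the error terms enter symmetrically their contribution is 0 mod 64. The
   result is 9 K(a) = 4 T(a) - 8 T(a)^2 mod 64.
   That T takes values in Z_2 is obtained by lifting the function Tr, which is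
   idempotent mod 2 for multiplicative convolution, to an idempotent e : F -> Z_2.
   Its Fourier coefficients are 0 or 1, hence are determined by their residues,
   and Fourier inversion gives (q - 1) e(x) = T(x). *)

Require Import Defs.
From HB Require Import structures.
From mathcomp Require Import all_boot all_order all_algebra all_fingroup.
From mathcomp Require Import all_solvable all_field.
From mathcomp Require Import ring zify.

Set Implicit Arguments.
Unset Strict Implicit.
Unset Printing Implicit Defensive.

Import Order.TTheory GRing.Theory Num.Theory.
Local Open Scope ring_scope.

(** * Digits, parity and divisibility in the 2-adic integers *)

Lemma Z2_digitD (x y : Z2) k : (x + y) k = ((x k + y k) %% 2 ^+ k)%Z.
Proof. by []. Qed.

Lemma Z2_digitM (x y : Z2) k : (x * y) k = ((x k * y k) %% 2 ^+ k)%Z.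
Proof. by []. Qed.

Lemma Z2_digit_int (m : int) k : (m%:~R : Z2) k = (m %% 2 ^+ k)%Z.
Proof.
have digit_nat j : (j%:R : Z2) k = (j%:Z %% 2 ^+ k)%Z.
  elim: j => [|j IHj]; first by [].
  by rewrite -addn1 natrD PoszD /= IHj modzDml modzDmr.
case: m => j; first exact: digit_nat.
by rewrite NegzE mulrNz /= digit_nat modzNm.
Qed.

Lemma Z2_digit_sum (I : finType) (P : pred I) (f : I -> Z2) k :
  ((\sum_(i | P i) f i : Z2) k = \sum_(i | P i) f i k %[mod 2 ^+ k])%Z.
Proof.
pose R (x : Z2) (m : int) := (x k = m %[mod 2 ^+ k])%Z.
suff: R (\sum_(i | P i) f i) (\sum_(i | P i) f i k) by [].
elim/big_rec2: _ => [|i m x _ xm]; first by rewrite /R /= modz_mod.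
by rewrite /R /= modz_mod -modzDmr xm modzDmr.
Qed.

Lemma Z2_digit1 (x : Z2) : x 1%N = 0 \/ x 1%N = 1.
Proof. by rewrite Z2P expr1; lia. Qed.

Lemma Z2_halve (x : Z2) : exists s : Z2, x = (x 1%N)%:~R + 2%:R * s.
Proof.
(* Halving costs one binary digit, so entry k of the quotient is computed from entry k + 1 of x. *)
pose f k := ((x k.+1 - x 1%N) %/ 2)%Z.
have even k : (2 %| x k.+1 - x 1%N)%Z.
  by rewrite -eqz_mod_dvd -(Z2_le x (isT : (1 <= k.+1)%N)).
have fE k : x k.+1 = x 1%N + 2 * f k by rewrite mulrC divzK //; ring.
have coh k : (f k.+1 = f k %[mod 2 ^+ k])%Z.
  have /eqP := Z2_le x (leqnSn k.+1); rewrite (fE k) (fE k.+1) eqz_mod_dvd.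
  have -> : x 1%N + 2 * f k.+1 - (x 1%N + 2 * f k) = 2 * (f k.+1 - f k) by ring.
  by rewrite exprS dvdz_mul2l // -eqz_mod_dvd => /eqP.
exists (Z2_mk coh); apply: Z2_eqP => -[|k].
  by rewrite [LHS]Z2P [RHS]Z2P expr0 !modz1.
rewrite Z2_digitD Z2_digitM Z2_digit_int (Z2_digit_int 2) modzDm.
by rewrite [Z2_mk coh k.+1]/= -modzDmr modzMm modzDmr -(fE k.+1) -Z2P.
Qed.

(** Brings a congruence established in Z_2 back to the integers, by comparing entries at level k. *)
Lemma Z2_dvd_int (m : int) k (w : Z2) :
  m%:~R = 2%:R ^+ k * w :> Z2 -> (2 ^+ k %| m)%Z.
Proof.
have -> : 2%:R ^+ k = (2 ^+ k : int)%:~R :> Z2 by rewrite rmorphXn.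
move=> /(congr1 (fun x : Z2 => x k)); rewrite Z2_digitM !Z2_digit_int modzz.
by rewrite mul0r mod0z => /dvdz_mod0P.
Qed.

(** Supplies the extra factor 2 in the binomial truncation and in the final reduction modulo 64. *)
Lemma Z2_even_prod (s : Z2) : exists u, s * (s - 1) = 2%:R * u.
Proof.
have [s' ->] := Z2_halve s.
have [-> | ->] := Z2_digit1 s.
  by exists (s' * (2%:R * s' - 1)); rewrite mulr0z; ring.
by exists (s' * (2%:R * s' + 1)); rewrite mulr1z; ring.
Qed.

(** * The cyclic unit group of F *)

Section CharacterSums.

Variables (n : nat) (F : finFieldType) (t : {unit F}).
Hypotheses (cardF : #|F| = (2 ^ n)%N) (gen_t : generator [set: {unit F}] t).

Let N := (2 ^ n - 1)%N.

Lemma card_unitsE : #|F|.-1 = N.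
Proof. by rewrite cardF /N subn1. Qed.

Lemma order_pred_gt0 : (0 < N)%N.
Proof. by have := finNzRing_gt1 F; rewrite cardF /N; lia. Qed.

Lemma generator_exp (x : F) : x != 0 -> exists j, x = val t ^+ j.
Proof.
rewrite -unitfE => ux; have : FinRing.Unit ux \in <[t]>%g by rewrite -(eqP gen_t) inE.
by case/cycleP => j xE; exists j; rewrite -FinRing.val_unitX -xE.
Qed.

Lemma expf_units (x : F) : x != 0 -> x ^+ N = 1.
Proof.
move=> x0; apply: (mulfI x0); rewrite -exprS mulr1.
have -> : N.+1 = #|F| by rewrite cardF /N subn1 prednK ?expn_gt0.
exact: expf_card.
Qed.

Lemma generator_neq0 : val t != 0.
Proof. by rewrite -unitfE; apply: (valP t). Qed.

Lemma generator_prim : N.-primitive_root (val t).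
Proof.
have ordt : #[t]%g = N by rewrite -card_unitsE -card_finField_unit (eqP gen_t).
have [m m_prim mN] := prim_order_exists order_pred_gt0 (expf_units generator_neq0).
suff -> : N = m by [].
apply/eqP; rewrite eqn_dvd mN andbT -ordt order_dvdn; apply/eqP/val_inj.
by rewrite FinRing.val_unitX /= prim_expr_order.
Qed.

(** * Orthogonality for a multiplicative map [M], later the identity of F or the Teichmüller
    character *)

Section Multiplicative.

Variables (R : fieldType) (M : F -> R).
Hypotheses (M1 : M 1 = 1) (MM : {morph M : x y / x * y}).
Hypothesis M_prim : N.-primitive_root (M (val t)).

Lemma mult_exp x j : M (x ^+ j) = M x ^+ j.
Proof. by elim: j => [|j IHj]; rewrite ?expr0 ?M1 // !exprS MM IHj. Qed.

Lemma mult_expN x : x != 0 -> M x ^+ N = 1.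
Proof. by move=> x0; rewrite -mult_exp expf_units. Qed.

(** Replacing x by [val t * x] multiplies the sum by [M (val t) ^+ k], which is 1 only if N divides
    k. *)
Lemma sum_mult_exp k :
  \sum_(x : F | x != 0) M x ^+ k = if (N %| k)%N then N%:R else 0.
Proof.
case: ifPn => [/dvdnP[c ->]|Nk].
  rewrite (eq_bigr (fun=> 1)); first by rewrite sumr_const cardC1 card_unitsE.
  by move=> x x0; rewrite mulnC exprM mult_expN ?expr1n.
have t0 : val t != 0 := generator_neq0.
have : (M (val t) ^+ k - 1) * \sum_(x : F | x != 0) M x ^+ k = 0.
  rewrite mulrBl mul1r mulr_sumr [X in _ - X](reindex_inj (mulfI t0)) /=.
  apply/eqP; rewrite subr_eq0; apply/eqP/eq_big => [x|x _].
    by rewrite mulf_eq0 negb_or t0.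
  by rewrite MM exprMn.
move/eqP; rewrite mulf_eq0 => /orP[|/eqP//].
by rewrite subr_eq0 -(prim_order_dvd M_prim) (negPf Nk).
Qed.

Lemma mult_orth a k l : (k < N)%N -> (l < N)%N ->
  \sum_(x : F | x != 0) M x^-1 ^+ k * M (a * x) ^+ l =
  if k == l then N%:R * M a ^+ k else 0.
Proof.
move=> kN lN; pose s := ((N - k) + l)%N.
have -> : \sum_(x : F | x != 0) M x^-1 ^+ k * M (a * x) ^+ l =
          M a ^+ l * \sum_(x : F | x != 0) M x ^+ s.
  rewrite mulr_sumr; apply: eq_bigr => x x0.
  have Mx0 : M x != 0.
    by apply/eqP => Mx; have/eqP := mult_expN x0; rewrite Mx expr0n eqn0Ngt order_pred_gt0 eq_sym oner_eq0.
  have MxV : M x * M x^-1 = 1 by rewrite -MM divff.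
  have -> : M x^-1 ^+ k = M x ^+ (N - k).
    apply: (mulfI (expf_neq0 k Mx0)).
    by rewrite -exprMn MxV expr1n -exprD subnKC ?mult_expN // ltnW.
  by rewrite MM exprMn exprD; ring.
rewrite sum_mult_exp; case: eqP => kl.
  by rewrite /s kl subnK ?dvdnn 1?mulrC // ltnW.
(* Since 0 < s < 2 N, divisibility by N would force s = N, that is k = l. *)
rewrite ifN ?mulr0 //; apply/negP => /dvdnP[[|[|c]]]; rewrite /s; lia.
Qed.

Lemma sum_mult_line z : z != 0 -> M z != 1 -> \sum_(j < N) M z ^+ j = 0.
Proof.
move=> z0 Mz; have /eqP := subrX1 (M z) N.
by rewrite mult_expN // subrr eq_sym mulf_eq0 subr_eq0 (negPf Mz) => /eqP.
Qed.

End Multiplicative.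

End CharacterSums.

(** * Elementary symmetric functions and Newton's identities *)

Section ElementarySymmetric.

Variable R : comNzRingType.

Definition esym (n : nat) (y : nat -> R) (k : nat) : R :=
  \sum_(A : {set 'I_n} | #|A| == k) \prod_(i in A) y i.

(** Expanding the product over subsets; as coefficients, the symmetric functions obey the recursion
    [esymS], on which all inductions below rest. *)
Lemma esym_coef n y k :
  esym n y k = (\prod_(i < n) ((y i)%:P * 'X + 1))`_k.
Proof.
rewrite bigA_distr coef_sum /esym big_mkcond; apply: eq_bigr => A _.
rewrite -big_mkcond /= big_split /= prodr_const.
rewrite -(rmorph_prod (@polyC R)) coefCM coefXn [k == _]eq_sym.
by case: eqP; rewrite ?mulr1 ?mulr0.
Qed.

Lemma esym0 n y : esym n y 0 = 1.
Proof.
rewrite esym_coef; elim: n => [|n IHn]; first by rewrite big_ord0 coef1.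
by rewrite big_ord_recr /= mulrDr mulr1 coefD mulrA coefMX add0r.
Qed.

Lemma esymS n y k : esym n.+1 y k.+1 = esym n y k.+1 + esym n y k * y n.
Proof.
rewrite !esym_coef big_ord_recr /= mulrDr mulr1 coefD mulrA coefMX coefMC.
by rewrite addrC.
Qed.

Lemma esym_ord0 y k : esym 0 y k.+1 = 0.
Proof. by rewrite esym_coef big_ord0 coef1. Qed.

Lemma esym1 n y : esym n y 1 = \sum_(i < n) y i.
Proof.
elim: n => [|n IHn]; first by rewrite esym_ord0 big_ord0.
by rewrite esymS IHn esym0 big_ord_recr /= mul1r.
Qed.

Lemma newton2 n (y : nat -> R) :
  \sum_(i < n) y i ^+ 2 = (\sum_(i < n) y i) ^+ 2 - 2%:R * esym n y 2.
Proof.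
elim: n => [|n IHn]; first by rewrite esym_ord0 !big_ord0; ring.
by rewrite !big_ord_recr /= IHn esymS esym1; ring.
Qed.

Lemma newton3 n (y : nat -> R) :
  \sum_(i < n) y i ^+ 3 = (\sum_(i < n) y i) ^+ 3
    - 3%:R * (\sum_(i < n) y i) * esym n y 2 + 3%:R * esym n y 3.
Proof.
elim: n => [|n IHn]; first by rewrite !esym_ord0 !big_ord0; ring.
by rewrite !big_ord_recr /= IHn !esymS !esym1; ring.
Qed.

End ElementarySymmetric.

(** * Exponents as sets of binary digits *)

(** The number with binary ones exactly at the positions in A: a product of conjugates over A is a
    single power with this exponent, of binary weight [#|A|]. *)
Definition setexp (n : nat) (A : {set 'I_n}) : nat := (\sum_(i in A) 2 ^ i)%N.

Lemma setexp_bits n (A : {set 'I_n}) :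
  setexp A = (\sum_(i < n) (i \in A) * 2 ^ i)%N.
Proof. by rewrite /setexp big_mkcond; apply: eq_bigr => i _; case: (i \in A); rewrite ?mul1n. Qed.

Lemma bits_inj n (b c : nat -> bool) :
  (\sum_(i < n) b i * 2 ^ i = \sum_(i < n) c i * 2 ^ i)%N ->
  forall i, (i < n)%N -> b i = c i.
Proof.
have shift (d : nat -> bool) m :
    (\sum_(i < m.+1) d i * 2 ^ i = d 0%N + 2 * \sum_(i < m) d i.+1 * 2 ^ i)%N.
  rewrite big_ord_recl /= muln1 big_distrr /=; congr (_ + _)%N.
  by apply: eq_bigr => i _; rewrite /bump /= add1n expnS mulnCA.
elim: n b c => [|n IHn] b c //; rewrite !shift.
move: (IHn (b \o succn) (c \o succn)) => /=.
move: (\sum_(i < n) _)%N (\sum_(i < n) _)%N => u v bc e.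
have [b0 uv] : b 0%N = c 0%N /\ u = v by case: (b 0%N) (c 0%N) e => -[] /=; lia.
by move=> [|i] //; apply: bc.
Qed.

Lemma setexp_inj n : injective (@setexp n).
Proof.
move=> A B; rewrite !setexp_bits => AB.
(* [bits_inj] takes digit functions on all of nat, so membership is extended by [false] beyond n. *)
pose bit (S : {set 'I_n}) i := if insub i is Some j then j \in S else false.
have bitE (S : {set 'I_n}) (i : 'I_n) : (i \in S) = bit S i by rewrite /bit (valK i).
apply/setP => i; rewrite !bitE.
apply: (bits_inj (n := n)) (ltn_ord i).
under eq_bigr do rewrite -bitE; under [RHS]eq_bigr do rewrite -bitE.
exact: AB.
Qed.

Lemma setexp_setT n : setexp [set: 'I_n] = (2 ^ n - 1)%N.
Proof.
rewrite /setexp; under eq_bigl do rewrite inE.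
by rewrite subn1 predn_exp mul1n.
Qed.

(** Only the full set reaches 2^n - 1, so exponents of weight below n lie in the range of
    [mult_orth]. *)
Lemma setexp_lt n (A : {set 'I_n}) : (#|A| < n)%N -> (setexp A < 2 ^ n - 1)%N.
Proof.
move=> An; rewrite -setexp_setT ltn_neqAle; apply/andP; split.
  apply/eqP => /setexp_inj AT; move: An; rewrite AT cardsT card_ord ltnn //.
by rewrite !setexp_bits; apply: leq_sum => i _; rewrite inE leq_mul2r leq_b1 orbT.
Qed.

(* Three times the truncation of (1 - 2)^T = sum_k (-2)^k binomial(T, k) after
   k = 3, the factor 3 clearing the denominator; the omitted terms vanish mod 16. *)
Definition sign_cubic (R : pzRingType) (T : R) : R :=
  3%:R - 20%:R * T + 18%:R * T ^+ 2 - 4%:R * T ^+ 3.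

(** The substitution x -> 1/(ax) exchanges 1/x and ax. It identifies the two mixed terms whenever a
    product of two sums is expanded. *)
Lemma sum_inv_swap (F : finFieldType) (V : nmodType) (f : F -> F -> V) (a : F) :
  a != 0 -> \sum_(x | x != 0) f x^-1 (a * x) = \sum_(x | x != 0) f (a * x) x^-1.
Proof.
move=> a0; have inj : injective (fun x : F => (a * x)^-1).
  by move=> x y /invr_inj/(mulfI a0).
rewrite (reindex_inj inj) /=; apply: eq_big => [x|x _].
  by rewrite invr_eq0 mulf_eq0 negb_or a0.
by rewrite invrK invfM mulVKf.
Qed.

(** * Orthogonality for symmetric functions of the conjugates *)

Section ConjugateSums.

Variables (n : nat) (F : finFieldType) (t : {unit F}).
Hypotheses (cardF : #|F| = (2 ^ n)%N) (gen_t : generator [set: {unit F}] t).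
Variables (R : fieldType) (M : F -> R).
Hypotheses (M1 : M 1 = 1) (MM : {morph M : x y / x * y}).
Hypothesis M_prim : (2 ^ n - 1)%N.-primitive_root (M (val t)).
Hypothesis n_gt3 : (3 < n)%N.

Let N : R := (2 ^ n - 1)%N%:R.
Let conj (x : F) (i : nat) : R := M x ^+ (2 ^ i).
Let T (x : F) : R := \sum_(i < n) conj x i.
Let P3 (x : F) : R := \sum_(i < n) conj x i ^+ 3.

Lemma esym_conj x k :
  esym n (conj x) k = \sum_(A : {set 'I_n} | #|A| == k) M x ^+ setexp A.
Proof. by apply: eq_bigr => A _; rewrite /setexp expr_sum. Qed.

Lemma conj_wrap x : x != 0 -> conj x n = conj x 0.
Proof.
move=> x0; rewrite /conj -[(2 ^ n)%N](@subnK 1) ?expn_gt0 // exprD.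
by rewrite (mult_expN cardF M1 MM) // mul1r.
Qed.

Lemma conj_ordS x (i : 'I_n) : x != 0 -> conj x (ordS i) = conj x i.+1.
Proof.
move=> x0; rewrite /ordS /=; have := ltn_ord i.
rewrite leq_eqVlt => /orP[/eqP ->|lt_i]; last by rewrite modn_small.
by rewrite modnn conj_wrap.
Qed.

Lemma conj_succ x i : conj x i.+1 = conj x i ^+ 2.
Proof. by rewrite /conj expnS mulnC exprM. Qed.

(** Squaring permutes the conjugates cyclically. *)
Lemma sum_conj_sqr x : x != 0 -> \sum_(i < n) conj x i ^+ 2 = T x.
Proof.
move=> x0; rewrite /T [RHS](reindex_inj (@ordS_inj n)).
by apply: eq_bigr => i _; rewrite conj_ordS // conj_succ.
Qed.

Lemma esym_conj2 x : x != 0 -> 2%:R * esym n (conj x) 2 = T x ^+ 2 - T x.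
Proof.
by move=> x0; rewrite -[X in _ - X](sum_conj_sqr x0) newton2 -/(T x); ring.
Qed.

Lemma esym_conj3 x : 3%:R * esym n (conj x) 3 =
  P3 x - T x ^+ 3 + 3%:R * T x * esym n (conj x) 2.
Proof. by rewrite /P3 newton3 -/(T x); ring. Qed.

Lemma ordS_neq (i : 'I_n) : ordS i != i.
Proof.
apply/eqP => /(congr1 val) /=; have := ltn_ord i.
rewrite leq_eqVlt => /orP[/eqP e|lt_i]; first by rewrite e modnn; lia.
by rewrite modn_small //; lia.
Qed.

(** Since y^3 = y y^2, the cube of a conjugate is the product of two cyclically adjacent ones, so
    its exponent has weight 2. *)
Lemma conj_cube x (i : 'I_n) :
  x != 0 -> conj x i ^+ 3 = M x ^+ setexp [set i; ordS i].
Proof.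
move=> x0; rewrite /setexp expr_sum big_setU1 ?big_set1 /=; last first.
  by rewrite inE eq_sym ordS_neq.
by rewrite -!/(conj _ _) conj_ordS // conj_succ exprS.
Qed.

Lemma setexp_orth a (A B : {set 'I_n}) : (#|A| < n)%N -> (#|B| < n)%N ->
  \sum_(x | x != 0) M x^-1 ^+ setexp A * M (a * x) ^+ setexp B =
  if A == B then N * M a ^+ setexp A else 0.
Proof.
move=> An Bn; rewrite (mult_orth cardF gen_t M1 MM M_prim) ?setexp_lt //.
by rewrite (inj_eq (@setexp_inj n)).
Qed.

(** Distinct subsets give distinct exponents, so only the pairs A = B survive, and these need k =
    l. *)
Lemma esym_orth a k l : (k < n)%N -> (l < n)%N ->
  \sum_(x | x != 0) esym n (conj x^-1) k * esym n (conj (a * x)) l =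
  if k == l then N * esym n (conj a) k else 0.
Proof.
move=> kn ln; under eq_bigr do rewrite !esym_conj big_distrlr /=.
rewrite exchange_big /=; under eq_bigr do rewrite exchange_big /=.
transitivity (\sum_(A : {set 'I_n} | #|A| == k)
    if k == l then N * M a ^+ setexp A else 0).
  apply: eq_bigr => A /eqP Ak.
  under eq_bigr => B /eqP Bl do rewrite setexp_orth ?Ak ?Bl //.
  case: eqP => [kl|kl].
    rewrite (bigD1 A) /= ?Ak ?kl // eqxx big1 ?addr0 // => B /andP[_ BA].
    by rewrite eq_sym (negPf BA).
  rewrite big1 // => B /eqP Bl; case: eqP => // AB.
  by case: kl; rewrite -Ak -Bl AB.
case: eqP => _; last by rewrite big1.
by rewrite -mulr_sumr esym_conj.
Qed.

(** By [conj_cube], P3 is the part of e_2 coming from adjacent pairs; hence it meets e_2 only. *)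
Lemma cube_orth a k : a != 0 -> (k < n)%N ->
  \sum_(x | x != 0) P3 x^-1 * esym n (conj (a * x)) k =
  if k == 2 then N * P3 a else 0.
Proof.
move=> a0 kn.
transitivity (\sum_(i < n) \sum_(B : {set 'I_n} | #|B| == k) \sum_(x | x != 0)
    M x^-1 ^+ setexp [set i; ordS i] * M (a * x) ^+ setexp B).
  rewrite exchange_big /=; under [RHS]eq_bigr do rewrite exchange_big /=.
  rewrite exchange_big /=; apply: eq_bigr => x x0.
  rewrite esym_conj /P3 big_distrlr /= exchange_big; apply: eq_bigr => B _.
  by apply: eq_bigr => i _; rewrite conj_cube // invr_eq0.
have card2 (i : 'I_n) : #|[set i; ordS i]| = 2 by rewrite cards2 eq_sym ordS_neq.
have n_gt2 : (2 < n)%N by apply: leq_trans n_gt3.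
transitivity (\sum_(i < n) if k == 2 then N * conj a i ^+ 3 else 0).
  apply: eq_bigr => i _.
  under eq_bigr => B /eqP Bk do rewrite setexp_orth ?card2 ?Bk //.
  case: eqP => [k2|k2].
    rewrite (bigD1 [set i; ordS i]) /= ?card2 ?k2 // eqxx conj_cube //.
    rewrite big1 ?addr0 // => B /andP[_ BA].
    by rewrite eq_sym (negPf BA).
  rewrite big1 // => B /eqP Bk; case: eqP => // AB.
  by case: k2; rewrite -Bk -AB card2.
case: eqP => _; last by rewrite big1.
by rewrite -mulr_sumr.
Qed.

Let c (k : nat) : R := nth 0 [:: 3%:R; - 14%:R; 12%:R; - 24%:R] k.
Let phi (x : F) : R := \sum_(k < 4) c k * esym n (conj x) k.

(** On conjugates T^2 = T + 2 e_2 and T^3 = 3 T + 6 e_2 + 6 e_3 - 2 P3; substituting these produces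
    the coefficients [c]. *)
Lemma sign_cubic_conj x : x != 0 -> sign_cubic (T x) = phi x + 8%:R * P3 x.
Proof.
move=> x0; rewrite /sign_cubic /phi !big_ord_recr big_ord0 /= /c /=.
rewrite esym0 esym1 -/(T x).
have e2 := esym_conj2 x0; have e3 := esym_conj3 x.
have -> : P3 x = 3%:R * esym n (conj x) 3 + T x ^+ 3 - 3%:R * T x * esym n (conj x) 2.
  by rewrite e3; ring.
(* The characteristic of [R] is arbitrary, so e_2 is eliminated only in the combination 2 e_2. *)
transitivity (3%:R - 14%:R * T x + 6%:R * (2%:R * esym n (conj x) 2)
  + 8%:R * T x ^+ 3 - 12%:R * T x * (2%:R * esym n (conj x) 2)); last by ring.
by rewrite e2; ring.
Qed.

Lemma sum_phi_phi a : \sum_(x | x != 0) phi x^-1 * phi (a * x) =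
  N * \sum_(k < 4) c k ^+ 2 * esym n (conj a) k.
Proof.
under eq_bigr do rewrite /phi big_distrlr /=.
rewrite exchange_big mulr_sumr; apply: eq_bigr => k _.
rewrite exchange_big (bigD1 k) //= [X in _ + X]big1 => [|l lk].
  under eq_bigr do rewrite mulrACA.
  rewrite -mulr_sumr esym_orth ?eqxx ?(leq_trans (ltn_ord k)) //; ring.
under eq_bigr do rewrite mulrACA.
rewrite -mulr_sumr esym_orth ?(leq_trans (ltn_ord _)) //.
by rewrite (inj_eq val_inj) eq_sym (negPf lk) mulr0.
Qed.

Lemma sum_cube_phi a : a != 0 ->
  \sum_(x | x != 0) P3 x^-1 * phi (a * x) = N * 12%:R * P3 a.
Proof.
move=> a0; under eq_bigr do rewrite /phi mulr_sumr.
rewrite exchange_big (bigD1 (inord 2)) //= [X in _ + X]big1 => [|l lk].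
  under eq_bigr do rewrite mulrCA.
  rewrite -mulr_sumr cube_orth ?inordK //= /c /=; last exact: leq_trans n_gt3.
  by ring.
under eq_bigr do rewrite mulrCA.
rewrite -mulr_sumr cube_orth ?(leq_trans (ltn_ord _)) // ifN ?mulr0 //.
by apply: contra lk => /eqP l2; apply/eqP/val_inj; rewrite /= l2 inordK.
Qed.

(** Only the product of the two P3 parts is left unevaluated, and it carries the factor 8^2 = 64. *)
Lemma sum_sign_cubic2 a : a != 0 ->
  \sum_(x | x != 0) sign_cubic (T x^-1) * sign_cubic (T (a * x)) =
  N * (9%:R + 124%:R * T a - 216%:R * T a ^+ 2 + 96%:R * T a ^+ 3
    + 384%:R * P3 a)
  + 64%:R * \sum_(x | x != 0) P3 x^-1 * P3 (a * x).
Proof.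
move=> a0.
have -> : \sum_(x | x != 0) sign_cubic (T x^-1) * sign_cubic (T (a * x)) =
    \sum_(x | x != 0) phi x^-1 * phi (a * x)
    + 8%:R * \sum_(x | x != 0) P3 x^-1 * phi (a * x)
    + 8%:R * \sum_(x | x != 0) P3 (a * x) * phi x^-1
    + 64%:R * \sum_(x | x != 0) P3 x^-1 * P3 (a * x).
  rewrite !mulr_sumr -!big_split; apply: eq_bigr => x x0 /=.
  by rewrite !sign_cubic_conj ?mulf_neq0 ?invr_eq0 //; ring.
congr (_ + _); rewrite -(sum_inv_swap (fun x y => P3 x * phi y)) // sum_cube_phi //.
rewrite sum_phi_phi !big_ord_recr big_ord0 /= /c /= esym0 esym1 -/(T a).
have e2 := esym_conj2 a0; have e3 := esym_conj3 a.
(* 9, 196, 144 and 576 are the squares of the [c k]; 192 = 2 * 8 * 12 comes from the two mixed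
   sums. *)
transitivity (N * (9%:R + 196%:R * T a + 72%:R * (2%:R * esym n (conj a) 2)
   + 192%:R * (3%:R * esym n (conj a) 3) + 192%:R * P3 a)); first by ring.
rewrite e3; transitivity (N * (9%:R + 196%:R * T a
   + 72%:R * (2%:R * esym n (conj a) 2) + 192%:R * (P3 a - T a ^+ 3)
   + 288%:R * T a * (2%:R * esym n (conj a) 2) + 192%:R * P3 a)); first by ring.
by rewrite e2; ring.
Qed.

(** Pairing with e_0 = 1 makes the plain sum a case of orthogonality, which leaves [c 0] = 3. *)
Lemma sum_sign_cubic : \sum_(x | x != 0) sign_cubic (T x) = 3%:R * N.
Proof.
transitivity (\sum_(x | x != 0) (esym n (conj x^-1) 0 * phi (1 * x)
     + 8%:R * (P3 x * esym n (conj x^-1) 0))).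
  by apply: eq_bigr => x x0; rewrite sign_cubic_conj // !esym0 !mul1r mulr1.
rewrite big_split /= -mulr_sumr.
have -> : \sum_(x | x != 0) P3 x * esym n (conj x^-1) 0 = 0.
  transitivity (\sum_(x | x != 0) P3 x^-1 * esym n (conj (1 * x)) 0).
    rewrite (sum_inv_swap (fun x y => P3 x * esym n (conj y) 0)) ?oner_eq0 //.
    by apply: eq_bigr => x _; rewrite mul1r.
  by rewrite cube_orth ?oner_eq0 // (leq_trans _ n_gt3).
under eq_bigr do rewrite /phi mulr_sumr.
rewrite exchange_big (bigD1 ord0) //= [X in _ + X + _]big1 => [|l l0].
  under eq_bigr do rewrite mulrCA.
  rewrite -mulr_sumr esym_orth ?(leq_trans _ n_gt3) //= esym0 /c /=; ring.
under eq_bigr do rewrite mulrCA.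
rewrite -mulr_sumr esym_orth ?(leq_trans _ n_gt3) ?(leq_trans (ltn_ord _)) //.
rewrite ifN ?mulr0 //; apply: contra l0 => /eqP l0.
by apply/eqP/val_inj.
Qed.

End ConjugateSums.

(** * Lifting convolution idempotents from Z/2 to Z_2 *)

Section ConvolutionIdempotent.

Variable F : finFieldType.

(** The convolution square on the unit group: the two arguments of f multiply to x. *)
Definition conv_sqr (V : pzRingType) (f : F -> V) (x : F) : V :=
  \sum_(y | y != 0) f y^-1 * f (x * y).

(** If f * f = f + 2^m g, squaring again changes f * f by 2^(m+1) f * g + 2^(2m) g * g, and 2m >= m
    + 1. *)
Lemma conv_sqr_lift (f : F -> int) m : (0 < m)%N ->
  (forall x, x != 0 -> (2 ^+ m %| conv_sqr f x - f x)%Z) ->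
  forall x, x != 0 ->
    (2 ^+ m.+1 %| conv_sqr (conv_sqr f) x - conv_sqr f x)%Z.
Proof.
move=> m_gt0 fm x x0; pose g y := ((conv_sqr f y - f y) %/ 2 ^+ m)%Z.
have fE y : y != 0 -> conv_sqr f y = f y + 2 ^+ m * g y.
  by move=> /fm y0; rewrite /g mulrC divzK //; ring.
have -> : conv_sqr (conv_sqr f) x - conv_sqr f x =
    2 ^+ m * (\sum_(y | y != 0) f y^-1 * g (x * y)
      + \sum_(y | y != 0) f (x * y) * g y^-1)
    + 2 ^+ m * 2 ^+ m * \sum_(y | y != 0) g y^-1 * g (x * y).
  rewrite [conv_sqr (conv_sqr f) x]/conv_sqr [X in _ - X]/conv_sqr -sumrB -big_split !mulr_sumr -big_split.
  by apply: eq_bigr => y y0 /=; rewrite !fE ?mulf_neq0 ?invr_eq0 //; ring.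
rewrite -(sum_inv_swap (fun y z => f y * g z)) //.
case: m m_gt0 {fm g fE} (g) => // m _ g /=.
apply/dvdzP; exists (\sum_(y | y != 0) f y^-1 * g (x * y)
  + 2 ^+ m * \sum_(y | y != 0) g y^-1 * g (x * y)).
by rewrite !exprS; ring.
Qed.

(** Iterated squares converge 2-adically, so iterate k can serve as entry k of the limit; [f 0 = 0]
    gives coherence at 0 as well. *)
Lemma conv_idempotent (f : F -> int) : f 0 = 0 ->
  (forall x, x != 0 -> (2 %| conv_sqr f x - f x)%Z) ->
  exists e : F -> Z2, (forall x, e x 1%N = (f x %% 2)%Z) /\
    (forall x, x != 0 -> conv_sqr e x = e x).
Proof.
move=> f0 f_even; pose fi k := iter k (@conv_sqr int) f.
have fi_dvd k x : x != 0 -> (2 ^+ k.+1 %| fi k.+1 x - fi k x)%Z.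
  by elim: k x => [|k IHk] x x0; [exact: f_even | exact: conv_sqr_lift].
have fi0 k : fi k 0 = 0.
  elim: k => [|k IHk] //; rewrite /fi iterS {1}/conv_sqr big1 // => y _.
  by rewrite mul0r -/(fi k) IHk mulr0.
have fi1 : conv_sqr f 0 = 0 := fi0 1%N.
have fi_coh x k : (fi k.+1 x = fi k x %[mod 2 ^+ k])%Z.
  apply/eqP; have [->|x0] := eqVneq x 0; first by rewrite !fi0.
  rewrite eqz_mod_dvd; apply: dvdz_trans (fi_dvd k x x0).
  by rewrite exprS dvdz_mull.
exists (fun x => Z2_mk (fi_coh x)); split=> x => [|x0]; last apply: Z2_eqP => k.
  rewrite /= expr1; apply/eqP; have [->|x0] := eqVneq x 0; first by rewrite f0 [conv_sqr f 0]fi1.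
  by rewrite eqz_mod_dvd (fi_dvd 0%N).
rewrite /conv_sqr -Z2_small Z2_digit_sum /= -(fi_coh x k).
apply/eqP; rewrite eqz_mod_dvd /fi iterS -/(fi k) /conv_sqr -sumrB.
elim/big_rec: _ => [|y d _ d_dvd]; first exact: dvdz0.
by rewrite rpredD // -eqz_mod_dvd modz_mod modzMm.
Qed.

End ConvolutionIdempotent.

(** * The absolute trace and its additive character *)

Section Trace.

Variables (n : nat) (F : finFieldType).
Hypothesis cardF : #|F| = (2 ^ n)%N.

Lemma card_pow2_pchar : 2%N \in [pchar F].
Proof. exact: card_finPcharP cardF isT. Qed.

Lemma two_eq0 : 2%:R = 0 :> F.
Proof. exact: pcharf0 card_pow2_pchar. Qed.

Lemma card_pow2_gt0 : (0 < n)%N.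
Proof. by have := finNzRing_gt1 F; rewrite cardF; case: n. Qed.

Lemma order_pred_eq1 : (2 ^ n - 1)%N%:R = 1 :> F.
Proof.
apply/eqP; rewrite -subr_eq0 natrB ?expn_gt0 // natrX two_eq0.
rewrite expr0n gtn_eqF ?card_pow2_gt0 // sub0r -opprD oppr_eq0.
by apply/eqP; apply: two_eq0.
Qed.

Lemma conj_sumD : {morph @conj_sum F n : x y / x + y}.
Proof.
move=> x y; rewrite /conj_sum -big_split; apply: eq_bigr => i _ /=.
elim: (i : nat) => [|k IHk]; first by rewrite !expr1.
rewrite expnS mulnC !exprM IHk.
by rewrite -(pFrobenius_autE card_pow2_pchar) rmorphD.
Qed.

Lemma conj_sum0 : conj_sum n 0 = 0 :> F.
Proof. by apply: (addrI (conj_sum n 0)); rewrite -conj_sumD !addr0. Qed.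

Lemma absTr_cases (x : F) : (absTr n x : nat) = 0%N \/ (absTr n x : nat) = 1%N.
Proof. by case: (absTr n x) => -[|[|]] //=; [left|right]. Qed.

Definition tr_sign (x : F) : int := (-1) ^+ (absTr n x : nat).

Lemma tr_signE (x : F) : tr_sign x = 1 - 2 * (absTr n x : nat)%:Z.
Proof. by rewrite /tr_sign; case: (absTr_cases x) => ->. Qed.

Lemma absTr0 : (absTr n (0 : F) : nat) = 0%N.
Proof.
have := absTrE 0 cardF; rewrite conj_sum0; case: (absTr_cases 0) => -> // /eqP.
by rewrite oner_eq0.
Qed.

Lemma tr_signD : {morph tr_sign : x y / x + y >-> x * y}.
Proof.
move=> x y; rewrite !tr_signE.
have := absTrE (x + y) cardF; rewrite conj_sumD -!absTrE //.
case: (absTr_cases x) => ->; case: (absTr_cases y) => ->;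
  case: (absTr_cases (x + y)) => -> //= /eqP;
  by rewrite ?addr0 ?add0r -?natrD ?two_eq0 ?oner_eq0 // eq_sym oner_eq0.
Qed.

Lemma kloosterman_sum (a : F) : (1 < n)%N -> kloosterman n a =
  1 + \sum_(x | x != 0) tr_sign x^-1 * tr_sign (a * x).
Proof.
(* This makes q - 2 positive, so that 0 ^+ (q - 2) = 0 in the term x = 0. *)
move=> n_gt1; have [m nE] : exists m, (2 ^ n = m.+4)%N.
  exists (2 ^ n - 4)%N; have := @leq_exp2l 2 2 n isT; rewrite n_gt1 /=; lia.
rewrite /kloosterman (bigD1 0) //=; congr (_ + _).
  by rewrite mulr0 addr0 nE !subSS subn0 expr0n /= absTr0.
apply: eq_bigr => x x0; rewrite -tr_signD /tr_sign.
suff -> : x ^+ (2 ^ n - 2) = x^-1 by [].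
apply: (mulfI x0); rewrite divff // -exprS.
by rewrite -(expf_units cardF x0); congr (_ ^+ _); lia.
Qed.

End Trace.

Lemma pow2_lt_order n i : (1 < n)%N -> (i < n)%N -> (2 ^ i < 2 ^ n - 1)%N.
Proof.
case: n => [|[|m]] // _ le_i; have : (2 ^ i <= 2 ^ m.+1)%N by rewrite leq_exp2l.
by rewrite [(2 ^ m.+2)%N]expnS [(2 ^ m.+1)%N]expnS; have := expn_gt0 2 m; lia.
Qed.

(** * Fourier analysis of the trace inside F *)

Section TraceSums.

Variables (n : nat) (F : finFieldType) (t : {unit F}).
Hypotheses (cardF : #|F| = (2 ^ n)%N) (gen_t : generator [set: {unit F}] t).
Hypothesis n_gt1 : (1 < n)%N.

(** Orthogonality for the identity character; the factor N is odd, hence 1 in F. *)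
Lemma id_mult_orth (a : F) k l : (k < 2 ^ n - 1)%N -> (l < 2 ^ n - 1)%N ->
  \sum_(x : F | x != 0) x^-1 ^+ k * (a * x) ^+ l = if k == l then a ^+ k else 0.
Proof.
move=> kN lN; have := mult_orth cardF gen_t (M := @idfun F) erefl (fun x y => erefl).
by move=> ->; rewrite /= ?order_pred_eq1 ?mul1r //; apply: generator_prim.
Qed.

Lemma conj_sum_coef k : (k < 2 ^ n - 1)%N ->
  \sum_(x : F | x != 0) x^-1 ^+ k * conj_sum n x = \sum_(i < n) (k == 2 ^ i)%N%:R.
Proof.
move=> kN; under eq_bigr do rewrite /conj_sum mulr_sumr.
rewrite exchange_big; apply: eq_bigr => i _.
transitivity (\sum_(x : F | x != 0) x^-1 ^+ k * (1 * x) ^+ (2 ^ i)).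
  by under [RHS]eq_bigr do rewrite mul1r.
by rewrite id_mult_orth ?pow2_lt_order // expr1n; case: eqP.
Qed.

(** The trace is a sum of distinct characters x^(2^i), which are orthogonal idempotents for
    convolution over F. *)
Lemma conv_sqr_conj_sum (x : F) : conv_sqr (@conj_sum F n) x = conj_sum n x.
Proof.
rewrite /conv_sqr; under eq_bigr do rewrite /conj_sum big_distrlr /=.
rewrite exchange_big; apply: eq_bigr => i _; rewrite exchange_big /=.
under eq_bigr do rewrite id_mult_orth ?pow2_lt_order //.
rewrite (bigD1 i) //= eqxx big1 ?addr0 // => j ji; rewrite ifN //.
by rewrite eqn_exp2l // eq_sym.
Qed.

Lemma sum_tr_sign : \sum_(x : F) tr_sign n x = 0.
Proof.
(* If the trace vanished identically, so would its Fourier coefficient at 2^0, which is 1. *)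
have [y /eqP y1] : exists y : F, absTr n y == 1%N :> nat.
  apply/existsP; apply: contraT; rewrite negb_exists => /forallP no_y.
  have := conj_sum_coef (pow2_lt_order n_gt1 (card_pow2_gt0 cardF)).
  rewrite big1 => [|x _]; last first.
    rewrite -absTrE //; case: (absTr_cases n x) (no_y x) => ->; rewrite ?mulr0 //.
  rewrite (bigD1 (Ordinal (card_pow2_gt0 cardF))) //= big1 => [|i i0].
    by rewrite addr0 => /eqP; rewrite eq_sym oner_eq0.
  rewrite eqn_exp2l //; case: (0%N =P i) => // i_eq0.
  by case/eqP: i0; apply: val_inj.
(* Translation by an element of trace 1 flips every sign. *)
have : \sum_(x : F) tr_sign n x = - \sum_(x : F) tr_sign n x.
  rewrite {1}(reindex_inj (addIr y)) -sumrN; apply: eq_bigr => x _.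
  by rewrite (tr_signD cardF) [tr_sign n y]tr_signE y1 mulrN1.
lia.
Qed.

End TraceSums.

(** * Reduction from Z_2 to F as a ring morphism *)

Section Residue.

Variable F : finFieldType.
Hypothesis chF : 2%N \in [pchar F].

(* The characteristic is recorded so that Z2_red can be declared a morphism. *)
Definition Z2_residue of 2%N \in [pchar F] : Z2 -> F := @Z2_red F.

Lemma intr_mod2 (m : int) : (m %% 2)%Z%:~R = m%:~R :> F.
Proof.
rewrite [in RHS](divz_eq m 2) [RHS]intrD [X in _ = X + _]intrM.
by rewrite (pcharf0 chF : 2%:~R = 0) mulr0 add0r.
Qed.

Lemma Z2_residue_is_zmod_morphism : zmod_morphism (Z2_residue chF).
Proof.
move=> x y; rewrite /Z2_residue /Z2_red Z2_digitD expr1 intr_mod2 intrD /=.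
by rewrite expr1 intr_mod2 mulrNz.
Qed.

Lemma Z2_residue_is_monoid_morphism : monoid_morphism (Z2_residue chF).
Proof.
split=> [|x y]; rewrite /Z2_residue /Z2_red //.
by rewrite Z2_digitM expr1 intr_mod2 intrM.
Qed.

HB.instance Definition _ :=
  GRing.isZmodMorphism.Build Z2 F (Z2_residue chF) Z2_residue_is_zmod_morphism.
HB.instance Definition _ :=
  GRing.isMonoidMorphism.Build Z2 F (Z2_residue chF) Z2_residue_is_monoid_morphism.

End Residue.

HB.instance Definition _ (C : closedFieldType) (iota : {rmorphism Q2 -> C}) :=
  GRing.RMorphism.copy (Z2_emb iota) (iota \o @FracField.tofrac Z2).

Lemma Z2_emb_inj (C : closedFieldType) (iota : {rmorphism Q2 -> C}) :
  injective (Z2_emb iota).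
Proof. by move=> x y /fmorph_inj/eqP; rewrite tofrac_eq => /eqP. Qed.

(** * The lifted trace takes values in Z_2 *)

Section LiftedTrace.

Variables (n : nat) (F : finFieldType) (t : {unit F}).
Hypotheses (cardF : #|F| = (2 ^ n)%N) (gen_t : generator [set: {unit F}] t).
Hypothesis n_gt1 : (1 < n)%N.
Variables (C : closedFieldType) (iota : {rmorphism Q2 -> C}) (xi : C).
Hypothesis xi_prim : (2 ^ n - 1)%N.-primitive_root xi.
Hypothesis xi_red : reduces_to iota t xi.

Let N := (2 ^ n - 1)%N.
Let w : F -> C := teichmuller t xi.
Local Notation emb := (Z2_emb iota).

Lemma teichmuller_gen j : w (val t ^+ j) = xi ^+ j.
Proof. by apply: teichmullerX => //; rewrite (card_unitsE cardF). Qed.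

Lemma teichmuller1 : w 1 = 1.
Proof. by rewrite -[1 in LHS](expr0 (val t)) teichmuller_gen. Qed.

Lemma teichmullerM : {morph w : x y / x * y}.
Proof.
move=> x y; have [->|x0] := eqVneq x 0; first by rewrite mul0r [w 0]teichmuller0 mul0r.
have [->|y0] := eqVneq y 0; first by rewrite mulr0 [w 0]teichmuller0 mulr0.
have [i ->] := generator_exp gen_t x0; have [j ->] := generator_exp gen_t y0.
by rewrite -exprD !teichmuller_gen exprD.
Qed.

Lemma teichmuller_prim : N.-primitive_root (w (val t)).
Proof. by rewrite -(expr1 (val t)) teichmuller_gen. Qed.

Lemma teichmuller_eq1 x : x != 0 -> w x = 1 -> x = 1.
Proof.
move=> x0; have [j ->] := generator_exp gen_t x0; rewrite teichmuller_gen => /eqP.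
rewrite -(prim_order_dvd xi_prim) (prim_order_dvd (generator_prim cardF gen_t)).
by move/eqP.
Qed.

Section Idempotent.

Variable e : F -> Z2.
Hypothesis e_tr : forall x, (e x 1%N)%:~R = conj_sum n x.
Hypothesis e_idem : forall x, x != 0 -> conv_sqr e x = e x.

Let fourier (j : nat) : C := \sum_(x | x != 0) emb (e x) * w x^-1 ^+ j.

(** The Fourier transform turns convolution into multiplication. *)
Lemma fourier_idem j : fourier j ^+ 2 = fourier j.
Proof.
rewrite {2}/fourier.
transitivity (\sum_(x | x != 0) \sum_(y | y != 0)
   emb (e y^-1) * emb (e (x * y)) * w x^-1 ^+ j); last first.
  apply: eq_bigr => x x0; rewrite -[in RHS]e_idem // /conv_sqr rmorph_sum mulr_suml.
  by apply: eq_bigr => y _; rewrite rmorphM.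
rewrite exchange_big expr2 {1}/fourier mulr_suml (reindex_inj invr_inj) /=.
apply: eq_big => [y|y y0]; first by rewrite invr_eq0.
rewrite invr_eq0 in y0.
rewrite /fourier mulr_sumr [RHS](reindex_inj (mulIf (invr_neq0 y0))) /=.
apply: eq_big => [x|x x0]; first by rewrite mulf_eq0 negb_or invr_neq0 ?andbT.
by rewrite mulfVK // invfM !invrK teichmullerM exprMn; ring.
Qed.

Lemma delta_sum (R : pzSemiRingType) (j : nat) :
  \sum_(i < n) (j == 2 ^ i)%N%:R = [exists i : 'I_n, j == 2 ^ i]%N%:R :> R.
Proof.
case: existsP => [[i /eqP ->]|no_i].
  rewrite (bigD1 i) //= eqxx big1 ?addr0 // => k ki.
  rewrite eqn_exp2l //; case: (i =P k :> nat) => // ik.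
  by case/eqP: ki; apply: val_inj.
by rewrite big1 // => i _; case: eqP => // ji; case: no_i; exists i; rewrite ji.
Qed.

(** [reduces_to] carries a relation for xi over Z_2 to one for t over F, where the Fourier
    coefficient of e becomes that of the trace. *)
Lemma fourier_residue j (b : bool) : (j < N)%N -> fourier j = b%:R ->
  b%:R = [exists i : 'I_n, j == 2 ^ i]%N%:R :> F.
Proof.
move=> jN fj.
have /fin_all_exists[l lE] : forall x : F, exists l, x != 0 -> x^-1 = val t ^+ l.
  move=> x; have [->|x0] := eqVneq x 0; first by exists 0%N.
  by have [l xE] := generator_exp gen_t (invr_neq0 x0); exists l.
(* The relation [fourier j - b%:R = 0] as a polynomial to be evaluated at xi, each [w x^-1] being xi
   to the logarithm [l x]. *)
pose p : {poly Z2} := \sum_(x | x != 0) (e x)%:P * 'X^(l x * j) - b%:R.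
have p_xi : (map_poly emb p).[xi] = 0.
  rewrite /p rmorphB rmorph_sum rmorph_nat hornerD hornerN.
  rewrite horner_sum -(rmorph_nat (@polyC C)) hornerC -fj; apply/eqP.
  rewrite subr_eq0; apply/eqP/eq_bigr => x x0.
  by rewrite rmorphM /= map_polyC map_polyXn hornerM hornerC hornerXn lE // exprM teichmuller_gen.
have := xi_red p_xi; rewrite -/(Z2_residue (card_pow2_pchar cardF)).
rewrite /p rmorphB rmorph_sum rmorph_nat hornerD hornerN.
rewrite horner_sum -(rmorph_nat (@polyC F)) hornerC => /eqP; rewrite subr_eq0 => /eqP <-.
rewrite -delta_sum -(conj_sum_coef cardF gen_t n_gt1 jN).
apply: eq_bigr => x x0.
by rewrite rmorphM /= map_polyC map_polyXn hornerM hornerC hornerXn lE // exprM -e_tr mulrC.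
Qed.

(** An idempotent of a field is 0 or 1, and its residue tells which, since these differ in F. *)
Lemma fourierE j : (j < N)%N -> fourier j = \sum_(i < n) (j == 2 ^ i)%N%:R.
Proof.
move=> jN; rewrite delta_sum; set v := [exists _, _].
have [b fj] : exists b : bool, fourier j = b%:R.
  have /eqP : fourier j * (fourier j - 1) = 0.
    by rewrite mulrBr mulr1 -expr2 fourier_idem subrr.
  rewrite mulf_eq0 subr_eq0 => /orP[/eqP ->|/eqP ->]; first by exists false.
  by exists true.
have := fourier_residue jN fj; rewrite -/v fj.
by case: b {fj}; case: v => //= /eqP; rewrite ?oner_eq0 // eq_sym oner_eq0.
Qed.

Lemma fourier_inversion z : z != 0 ->
  N%:R * emb (e z) = lifted_trace t xi n z.
Proof.
move=> z0; transitivity (\sum_(j < N) fourier j * w z ^+ j).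
  under [RHS]eq_bigr do rewrite /fourier mulr_suml.
  rewrite exchange_big (bigD1 z) //= [X in _ + X]big1 => [|x /andP[x0 xz]].
    rewrite addr0 (eq_bigr (fun=> emb (e z))); last first.
      move=> j _; rewrite -mulrA -exprMn -teichmullerM mulVf //.
      by rewrite teichmuller1 expr1n mulr1.
    by rewrite sumr_const card_ord mulr_natl.
  under eq_bigr do rewrite -mulrA -exprMn -teichmullerM.
  rewrite -mulr_sumr (sum_mult_line cardF teichmuller1 teichmullerM) ?mulr0 //.
    by rewrite mulf_neq0 ?invr_eq0.
  apply: contra xz => /eqP /teichmuller_eq1 xz; apply/eqP.
  by apply: (mulfI (invr_neq0 x0)); rewrite mulVf // xz // mulf_neq0 ?invr_eq0.
under eq_bigr => j _ do rewrite fourierE // mulr_suml.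
rewrite exchange_big; apply: eq_bigr => i _.
rewrite (bigD1 (Ordinal (pow2_lt_order n_gt1 (ltn_ord i)))) //= eqxx mul1r.
rewrite big1 ?addr0 // => j ji; case: eqP => [ji'|]; last by rewrite mul0r.
by case/eqP: ji; apply: val_inj.
Qed.

End Idempotent.

Lemma lifted_trace_Z2 : exists tau : F -> Z2, forall x,
  emb (tau x) = lifted_trace t xi n x /\
  exists s, tau x = (absTr n x : nat)%:R + 2%:R * s.
Proof.
pose f (x : F) : int := absTr n x : nat.
have f_red x : (f x)%:~R = conj_sum n x by rewrite -absTrE.
have f_even x : x != 0 -> (2 %| conv_sqr f x - f x)%Z.
  move=> x0; rewrite (dvdz_pcharf (card_pow2_pchar cardF)) rmorphB /=.
  rewrite f_red -(conv_sqr_conj_sum cardF gen_t n_gt1) subr_eq0 rmorph_sum.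
  by apply/eqP/eq_bigr => y _; rewrite rmorphM /= !f_red.
have f0 : f 0 = 0 by rewrite /f (absTr0 cardF).
have [e [e1 e_idem]] := conv_idempotent f0 f_even.
have e1f x : e x 1%N = f x.
  by rewrite e1 /f; case: (absTr_cases n x) => ->.
(* Fourier inversion covers nonzero arguments; at 0 the lifted trace is 0. *)
exists (fun x => if x == 0 then 0 else N%:R * e x) => x.
have [->|x0] := eqVneq x 0; last split.
- split; last by exists 0; rewrite (absTr0 cardF) mulr0 addr0.
  rewrite [emb 0]rmorph0 /lifted_trace big1 // => i _.
  by rewrite teichmuller0 expr0n expn_eq0.
- rewrite [emb _]rmorphM rmorph_nat -(fourier_inversion _ e_idem) // => y.
  by rewrite e1f f_red.
have [s es] := Z2_halve (e x); rewrite e1f in es.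
(* N = 1 + 2 (2^(n-1) - 1) is odd, so N e(x) has the parity of e(x). *)
exists (s + (2 ^ n.-1 - 1)%N%:R * e x); rewrite mulrDr addrA -[X in X + _]es.
have -> : N = (1 + 2 * (2 ^ n.-1 - 1))%N.
  by rewrite /N -{1}(prednK (card_pow2_gt0 cardF)) expnS; have := expn_gt0 2 n.-1; lia.
by rewrite natrD natrM; ring.
Qed.

End LiftedTrace.

(** The two sides differ by 72 s(s - 1) for b = 0 and 24 s(s - 1) for b = 1, up to multiples of 32;
    evenness of s(s - 1) gives 16. *)
Lemma sign_cubicE (s : Z2) (b : nat) : b = 0%N \/ b = 1%N ->
  exists r, 3%:R * (1 - 2%:R * b%:R) =
    sign_cubic (b%:R + 2%:R * s) + 16%:R * r :> Z2.
Proof.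
have [u su] := Z2_even_prod s; rewrite /sign_cubic => -[->|->].
  exists (- 9%:R * u - 2%:R * s + 2%:R * s ^+ 3).
  have -> : 16%:R * (- 9%:R * u - 2%:R * s + 2%:R * s ^+ 3) =
      - 72%:R * (2%:R * u) - 32%:R * s + 32%:R * s ^+ 3 by ring.
  by rewrite -su; ring.
exists (- 3%:R * u - 2%:R * s + 2%:R * s ^+ 3).
have -> : 16%:R * (- 3%:R * u - 2%:R * s + 2%:R * s ^+ 3) =
    - 24%:R * (2%:R * u) - 32%:R * s + 32%:R * s ^+ 3 by ring.
by rewrite -su; ring.
Qed.

(** * The congruence for Kloosterman sums modulo 64 *)

Section Congruence.

Variables (n : nat) (F : finFieldType) (t : {unit F}).
Hypotheses (cardF : #|F| = (2 ^ n)%N) (gen_t : generator [set: {unit F}] t).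
Hypothesis n_gt5 : (5 < n)%N.
Variables (C : closedFieldType) (iota : {rmorphism Q2 -> C}) (xi : C).
Hypothesis xi_prim : (2 ^ n - 1)%N.-primitive_root xi.
Variable tau : F -> Z2.
Hypothesis tauE : forall x, Z2_emb iota (tau x) = lifted_trace t xi n x.
Hypothesis tau_tr : forall x, exists s, tau x = (absTr n x : nat)%:R + 2%:R * s.

Let N : Z2 := (2 ^ n - 1)%N%:R.
Let S (x : F) : Z2 := sign_cubic (tau x).
Let chi (x : F) : Z2 := (tr_sign n x)%:~R.
Let w : F -> C := teichmuller t xi.

Let n_gt3 : (3 < n)%N. Proof. by apply: leq_trans n_gt5. Qed.
Let n_gt1 : (1 < n)%N. Proof. by apply: leq_trans n_gt5. Qed.
Let w1 : w 1 = 1 := teichmuller1 cardF gen_t xi_prim.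
Let wM : {morph w : x y / x * y} := teichmullerM cardF gen_t xi_prim.
Let w_prim : (2 ^ n - 1)%N.-primitive_root (w (val t)) :=
  teichmuller_prim cardF gen_t xi_prim.

Lemma emb_sign_cubic x : Z2_emb iota (S x) =
  sign_cubic (\sum_(i < n) w x ^+ (2 ^ i)).
Proof.
have := tauE x; rewrite /lifted_trace -/w => <-.
by rewrite /S /sign_cubic !(rmorph_nat, rmorphN, rmorphD, rmorphM, rmorphXn).
Qed.

(** Thus P3 takes values in Z_2, so the remainder in [sum_S_S] is divisible by 64 there. *)
Lemma emb_tau_cube x : Z2_emb iota (tau (x ^+ 3)) =
  \sum_(i < n) (w x ^+ (2 ^ i)) ^+ 3.
Proof.
rewrite tauE; apply: eq_bigr => i _; rewrite -/w (mult_exp w1 wM).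
by rewrite exprAC.
Qed.

Lemma sum_S_S a : a != 0 -> \sum_(x | x != 0) S x^-1 * S (a * x) =
  N * (9%:R + 124%:R * tau a - 216%:R * tau a ^+ 2 + 96%:R * tau a ^+ 3
    + 384%:R * tau (a ^+ 3))
  + 64%:R * \sum_(x | x != 0) tau (x^-1 ^+ 3) * tau ((a * x) ^+ 3).
Proof.
move=> a0; apply: (@Z2_emb_inj C iota).
have := sum_sign_cubic2 cardF gen_t w1 wM w_prim n_gt3 a0.
under eq_bigr do rewrite -!emb_sign_cubic -rmorphM.
under [X in _ + _ * X]eq_bigr do rewrite -!emb_tau_cube -rmorphM.
rewrite -!rmorph_sum /= => ->.
have := tauE a; rewrite /lifted_trace -/w => <-; rewrite -emb_tau_cube.
by rewrite /N !(rmorph_nat, rmorphN, rmorphD, rmorphM, rmorphXn).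
Qed.

Lemma sum_S : \sum_(x | x != 0) S x = 3%:R * N.
Proof.
apply: (@Z2_emb_inj C iota).
have := sum_sign_cubic cardF gen_t w1 wM w_prim n_gt3.
under eq_bigr do rewrite -emb_sign_cubic.
by rewrite -rmorph_sum => ->; rewrite rmorphM !rmorph_nat.
Qed.

Lemma sum_chi : \sum_(x | x != 0) chi x = -1.
Proof.
have := sum_tr_sign cardF gen_t n_gt1; rewrite (bigD1 0) //=.
rewrite {1}/tr_sign (absTr0 cardF) expr0 => /(congr1 (fun m : int => m%:~R : Z2)).
rewrite /chi -rmorph_sum /= intrD mulr0z => /eqP.
by rewrite addrC addr_eq0 => /eqP.
Qed.

Lemma kloosterman_congr a : exists W,
  (9 * kloosterman n a)%:~R = 4%:R * tau a - 8%:R * tau a ^+ 2 + 64%:R * W.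
Proof.
have KE : (kloosterman n a)%:~R = 1 + \sum_(x | x != 0) chi x^-1 * chi (a * x).
  rewrite (kloosterman_sum cardF) // intrD; congr (_ + _).
  by rewrite rmorph_sum; apply: eq_bigr => x _; rewrite rmorphM.
have chi0 : chi 0 = 1 by rewrite /chi /tr_sign (absTr0 cardF).
(* Orthogonality was shown for a != 0; at a = 0 the Kloosterman sum is 1 - 1 = 0, and tau vanishes
   too. *)
have [aE|a0] := eqVneq a 0.
  have tau0 : tau 0 = 0.
    apply: (@Z2_emb_inj C iota); rewrite tauE rmorph0 /lifted_trace big1 // => i _.
    by rewrite teichmuller0 expr0n expn_eq0.
  exists 0; rewrite intrM KE aE tau0.
  have -> : \sum_(x | x != 0) chi x^-1 * chi (0 * x) = -1.
    rewrite -sum_chi [RHS](reindex_inj invr_inj); apply: eq_big => x.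
      by rewrite invr_eq0.
    by rewrite mul0r chi0 mulr1.
  by ring.
have chiE x : chi x = 1 - 2%:R * (absTr n x : nat)%:R.
  rewrite /chi /tr_sign; case: (absTr_cases n x) => ->.
    by rewrite expr0 mulr1z; ring.
  by rewrite expr1 mulrNz mulr1z; ring.
have /fin_all_exists[r rE] : forall x, exists r, 3%:R * chi x = S x + 16%:R * r.
  by move=> x; have [s sE] := tau_tr x; rewrite chiE /S sE; apply/sign_cubicE/absTr_cases.
have SE x : S x = 3%:R * chi x - 16%:R * r x by rewrite rE; ring.
(* Half the sum of the errors r: 16 times that sum is 3 (-1) - 3 N = -3 * 2^n. *)
pose R : Z2 := - 3%:R * 2%:R ^+ (n - 5).
have pow2E k : (k <= n)%N -> N = 2%:R ^+ k * 2%:R ^+ (n - k) - 1.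
  by move=> kn; rewrite /N natrB ?expn_gt0 // natrX -exprD subnKC.
have sum_r : \sum_(x | x != 0) r x = 2%:R * R.
  have n2 : 2%:R != 0 :> Z2.
    by apply/eqP => /(congr1 (fun z : Z2 => z 2%N)); rewrite (Z2_digit_int 2).
  have n16 : 16%:R != 0 :> Z2 by rewrite -[16%N]/(2 ^ 4)%N natrX expf_neq0.
  apply: (mulfI n16); rewrite mulr_sumr.
  transitivity (\sum_(x | x != 0) (3%:R * chi x - S x)).
    by apply: eq_bigr => x _; rewrite SE; ring.
  rewrite sumrB -mulr_sumr sum_chi sum_S (pow2E 5%N) /R; last exact: ltnW.
  by ring.
pose B : Z2 := \sum_(x | x != 0) r x^-1 * (absTr n (a * x) : nat)%:R.
(* As chi is 1 modulo 2, this sum has the parity of the sum of r, which is even; the mixed terms,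
   with factor 96, thus become multiples of 192 = 3 * 64. *)
have sum_r_chi :
    \sum_(x | x != 0) r x^-1 * chi (a * x) = 2%:R * R - 2%:R * B.
  have <- : \sum_(x | x != 0) r x^-1 = 2%:R * R.
    rewrite -sum_r [RHS](reindex_inj invr_inj).
    by apply: eq_bigl => x; rewrite invr_eq0.
  by rewrite /B mulr_sumr -sumrB; apply: eq_bigr => x _; rewrite chiE; ring.
pose D := \sum_(x | x != 0) r x^-1 * r (a * x).
have SS : \sum_(x | x != 0) S x^-1 * S (a * x) =
    9%:R * ((kloosterman n a)%:~R - 1)
    - 96%:R * \sum_(x | x != 0) r x^-1 * chi (a * x) + 256%:R * D.
  transitivity (9%:R * \sum_(x | x != 0) chi x^-1 * chi (a * x)
    - 48%:R * \sum_(x | x != 0) r x^-1 * chi (a * x)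
    - 48%:R * \sum_(x | x != 0) r (a * x) * chi x^-1 + 256%:R * D).
    rewrite !mulr_sumr -!sumrB -big_split; apply: eq_bigr => x _ /=.
    by rewrite !SE; ring.
  by rewrite -(sum_inv_swap (fun x y => r x * chi y)) // KE; ring.
(* Here n >= 6 enters: N = 64 q - 1 acts as -1 modulo 64. *)
have := sum_S_S a0; rewrite SS sum_r_chi (pow2E 6) // => eqK.
have [u uE] := Z2_even_prod (tau a).
set E := \sum_(x | x != 0) _ in eqK; set q := 2%:R ^+ (n - 6) in eqK.
(* With T = tau a, what remains is 9 K = -124 T + 216 T^2 - 96 T^3 = 4 T - 8 T^2 + 32 T^2 (T - 1)
   modulo 64, and the last term is 64 T u. *)
exists (3%:R * (R - B) - 4%:R * D + E
  + q * (9%:R + 124%:R * tau a - 216%:R * tau a ^+ 2 + 96%:R * tau a ^+ 3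
         + 384%:R * tau (a ^+ 3))
  - 2%:R * tau a + 4%:R * tau a ^+ 2 - 2%:R * tau a ^+ 3
  - 6%:R * tau (a ^+ 3) + tau a * u).
transitivity (9%:R * ((kloosterman n a)%:~R - 1) - 96%:R * (2%:R * R - 2%:R * B)
  + 256%:R * D + 9%:R + 192%:R * (R - B) - 256%:R * D).
  by rewrite intrM; ring.
rewrite eqK; transitivity (4%:R * tau a - 8%:R * tau a ^+ 2 + 64%:R
  * (3%:R * (R - B) - 4%:R * D + E
  + q * (9%:R + 124%:R * tau a - 216%:R * tau a ^+ 2 + 96%:R * tau a ^+ 3
         + 384%:R * tau (a ^+ 3))
  - 2%:R * tau a + 4%:R * tau a ^+ 2 - 2%:R * tau a ^+ 3
  - 6%:R * tau (a ^+ 3)) + 32%:R * tau a * (tau a * (tau a - 1))).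
  by ring.
by rewrite uE; ring.
Qed.

End Congruence.

(** * Reading the table off the congruence *)

Theorem theorem7p1 (n : nat) (F : finFieldType)
    (C : closedFieldType) (iota : {rmorphism Q2 -> C})
    (xi : C) (t : {unit F}) :
  (6 <= n)%N ->
  #|F| = (2 ^ n)%N ->
  is_alg_closure_Q2 iota ->
  (2 ^ n - 1)%N.-primitive_root xi ->
  generator [set: {unit F}] t ->
  reduces_to iota t xi ->
  forall a : F,
  exists2 z : Z2, Z2_emb iota z = lifted_trace t xi n a &
    forall c k : nat, (c, k) \in kloosterman_table ->
      Z2_congr 16 z c%:R -> (kloosterman n a = k%:Z %[mod 64])%Z.
Proof.
move=> n_gt5 cardF _ xi_prim gen_t xi_red a.
have n_gt1 : (1 < n)%N by apply: leq_trans n_gt5.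
have [tau tauP] := lifted_trace_Z2 cardF gen_t n_gt1 xi_prim xi_red.
have tauE x := (tauP x).1; have tau_tr x := (tauP x).2.
exists (tau a) => [|c k ck [w zw]]; first exact: tauE.
have [W KW] := kloosterman_congr cardF gen_t n_gt5 xi_prim tauE tau_tr a.
have tE : tau a = c%:R + 16%:R * w by rewrite -zw; ring.
(* Replacing tau a by c changes 4 T - 8 T^2 by a multiple of 64. *)
have : (2 ^+ 6 %| 9 * kloosterman n a - 4 * c%:Z + 8 * c%:Z ^+ 2)%Z.
  apply: (Z2_dvd_int (w := W + w - 4%:R * c%:R * w - 32%:R * w ^+ 2)).
  by rewrite !(intrD, mulrNz) KW tE !intrM; ring.
move: (kloosterman n a) ck => K; rewrite !inE => ck /dvdzP[v Kv].
(* In each column c is explicit, and 9 is invertible modulo 64, so K is determined. *)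
by move: ck; do ![case/orP]; move=> /eqP[ec ek]; rewrite {}ec {}ek in Kv *; lia.
Qed.
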